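(* Let $u=(U(x,t),0,0)$, with a function $P=P(x,t)$, be a solution for all $t\in\mathbb{R}$ of the Navier-Stokes equations $$\frac{\partial}{\partial t}u+(u\cdot\nabla)u=\nu\Delta u-\nabla P,\qquad \nabla\cdot u=0$$ in the channel $\mathcal{O}=\mathbb{R}\times\mathbb{R}\times[0,h]$ with the no-slip condition $u=0$ on $\{x_3=0\}\cup\{x_3=h\}$, and suppose that: (i) $u\in C^\infty(\mathcal{O}\times\mathbb{R})$; (ii) $u$ is periodic in $x_1$ and $x_2$ with periods $\Pi_1$ and $\Pi_2$ respectively; (iii) $\sup_{t\in\mathbb{R}}\int_0^{\Pi_1}\int_0^{\Pi_2}\int_0^h u(x,t)\cdot u(x,t)\,dx<\infty$. Then the average $$\langle U\rangle_2(x_3,t):=\frac{1}{\Pi_2}\int_0^{\Pi_2}U(x_2,x_3,t)\,dx_2$$ satisfies $\langle U\rangle_2(h-x_3,t)=\langle U\rangle_2(x_3,t)$ for all $x_3\in[0,h]$ and $t\in\mathbb{R}$.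
   Context: Here $x=(x_1,x_2,x_3)$; $\nu>0$ (kinematic viscosity), $h>0$, $\Pi_1,\Pi_2>0$ are constants. $P=p+\Phi$ is the sum of the pressure $p(x,t)$ and a time-independent potential $\Phi(x)$. The divergence-free condition gives $\partial U/\partial x_1=0$, so $U$ is written $U=U(x_2,x_3,t)$. *)

(* Defs.v *)
From HB Require Import structures.
From mathcomp Require Import all_boot all_order all_algebra.
From mathcomp Require Import all_classical all_reals all_analysis.
Set Implicit Arguments.
Unset Strict Implicit.
Unset Printing Implicit Defensive.
Import Order.TTheory GRing.Theory Num.Theory.
Import numFieldNormedType.Exports.
Local Open Scope classical_set_scope.
Local Open Scope ring_scope.

Section derive_in.
Variables (R : realType) (V W : normedModType R).

(* [derivable] and [derive] of MathComp-Analysis, with the increments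
   restricted to those that stay in D: at a wall of the channel the derivative
   in the normal direction is one-sided, and the values of f outside D are
   never used. *)
Definition diff_quot (f : V -> W) (a v : V) (s : R) : W :=
  s^-1 *: ((f \o shift a) (s *: v) - f a).

Definition increments_in (D : set V) (a v : V) : set_system R :=
  within [set s : R | D (s *: v + a)] 0^'.

Definition derivable_in (D : set V) (f : V -> W) (a v : V) : Prop :=
  cvg (diff_quot f a v @ increments_in D a v).

Definition derive_in (D : set V) (v : V) (f : V -> W) (a : V) : W :=
  lim (diff_quot f a v @ increments_in D a v).

End derive_in.

(* The coordinates x_1, x_2, x_3 have indices 0, 1, 2 in 'I_3; a point
   (x, t) of spacetime R is a position and a time. *)
Notation spacetime R := ('rV[R]_3 * R)%type.

Section navier_stokes.
Variable R : realType.

Definition vec3 (a b c : R) : 'rV[R]_3 := \row_(i < 3) [:: a; b; c]`_i.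

Definition channel (h : R) : set 'rV[R]_3 :=
  [set x : 'rV[R]_3 | 0 <= x 0 2 <= h].

Definition channelT (h : R) : set (spacetime R) := channel h `*` [set: R].

Definition e_x (i : 'I_3) : spacetime R := (delta_mx 0 i, 0).
Definition e_t : spacetime R := (0, 1).

Section operators.
Variable D : set (spacetime R).

Definition d_x (W : normedModType R) (i : 'I_3) (f : spacetime R -> W) :
  spacetime R -> W := derive_in D (e_x i) f.

Definition d_t (W : normedModType R) (f : spacetime R -> W) :
  spacetime R -> W :=
  derive_in D e_t f.

Fixpoint Ck (W : normedModType R) (k : nat) (f : spacetime R -> W) : Prop :=
  {within D, continuous f} /\
  if k is k'.+1 then
    [/\ forall z, D z ->
          (forall i, derivable_in D f z (e_x i)) /\ derivable_in D f z e_t,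
        forall i, Ck k' (d_x i f)
      & Ck k' (d_t f)]
  else True.

Definition smooth (W : normedModType R) (f : spacetime R -> W) : Prop :=
  forall k, Ck k f.

Definition gradient (P : spacetime R -> R) (z : spacetime R) : 'rV[R]_3 :=
  \row_(i < 3) d_x i P z.

Definition laplacian (u : spacetime R -> 'rV[R]_3) (z : spacetime R) :
  'rV[R]_3 :=
  \sum_(i < 3) d_x i (d_x i u) z.

Definition divergence (u : spacetime R -> 'rV[R]_3) (z : spacetime R) : R :=
  \sum_(i < 3) d_x i (fun w => u w 0 i) z.

Definition advection (u : spacetime R -> 'rV[R]_3) (z : spacetime R) :
  'rV[R]_3 :=
  \sum_(i < 3) u z 0 i *: d_x i u z.

Definition navier_stokes (nu : R) (u : spacetime R -> 'rV[R]_3)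
    (P : spacetime R -> R) : Prop :=
  forall z, D z ->
    [/\ forall i, derivable_in D P z (e_x i),
        d_t u z + advection u z = nu *: laplacian u z - gradient P z
      & divergence u z = 0].

End operators.

Definition no_slip (h : R) (u : spacetime R -> 'rV[R]_3) : Prop :=
  forall (x : 'rV[R]_3) (t : R), x 0 2 = 0 \/ x 0 2 = h -> u (x, t) = 0.

Definition periodic_x12 (h Pi1 Pi2 : R) (u : spacetime R -> 'rV[R]_3) : Prop :=
  forall (x : 'rV[R]_3) (t : R), channel h x ->
    u (x + Pi1 *: delta_mx 0 0, t) = u (x, t) /\
    u (x + Pi2 *: delta_mx 0 1, t) = u (x, t).

Definition dot (v w : 'rV[R]_3) : R :=
  \sum_(i < 3) v 0 i * w 0 i.

Definition energy (h Pi1 Pi2 : R) (u : spacetime R -> 'rV[R]_3) (t : R) :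
  \bar R :=
  (\int[lebesgue_measure]_(x1 in `[0%R, Pi1])
     \int[lebesgue_measure]_(x2 in `[0%R, Pi2])
       \int[lebesgue_measure]_(x3 in `[0%R, h])
         (dot (u (vec3 x1 x2 x3, t)) (u (vec3 x1 x2 x3, t)))%:E)%E.

(* For a divergence-free (U, 0, 0) the value does not depend on x1. *)
Definition avg2 (Pi2 : R) (U : spacetime R -> R) (x1 x3 t : R) : R :=
  Pi2^-1 *
  \int[lebesgue_measure]_(x2 in `[0%R, Pi2]) U (vec3 x1 x2 x3, t).

End navier_stokes.

(* Main.v *)
(** The transverse components of the momentum equation give dP/dx3 = 0, so the
    pressure gradient along x1 takes the same value at x3 and at h - x3.  Hence,
    for fixed x1, Z(x2, x3, t) = U(x2, h - x3, t) - U(x2, x3, t) solves the heat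
    equation Z_t = nu (Z_22 + Z_33), vanishes at both walls, is periodic in x2,
    and is bounded in L2 uniformly in t.  The square G = Z^2 satisfies
    G_t <= nu (G_22 + G_33); integrating it against the weight
    w(x3) = x3 (h - x3), for which w'' = -2 <= -(8 / h^2) w, the quantity
    E = \int \int G w satisfies E' <= -(8 nu / h^2) E.  A nonnegative function
    with this property that is bounded on the whole time axis is zero: going
    backwards in time it would grow without bound.  So U itself, not only its
    average, is symmetric. *)

Require Import Defs.
From HB Require Import structures.
From mathcomp Require Import all_boot all_order all_algebra.
From mathcomp Require Import all_classical all_reals all_analysis.
From mathcomp Require Import ring lra.
Set Implicit Arguments.
Unset Strict Implicit.
Unset Printing Implicit Defensive.
Import Order.TTheory GRing.Theory Num.Theory.
Import numFieldNormedType.Exports.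
Local Open Scope classical_set_scope.
Local Open Scope ring_scope.

(** * Integrals of continuous functions *)

Lemma continuous_pair {S T U : topologicalType} (f : S -> T) (g : S -> U) :
  continuous f -> continuous g -> continuous (fun x => (f x, g x)).
Proof.
by move=> cf cg x; apply: (cvg_pair (cf x) (cg x)).
Qed.

Lemma is_derive_mulf {R : realType} (f g : R -> R) (x df dg : R) :
  is_derive x 1 f df -> is_derive x 1 g dg ->
  is_derive x 1 (fun y => f y * g y) (f x * dg + g x * df).
Proof. by move=> ? ?; exact: (@is_deriveM _ _ f g). Qed.

Section parametric_integrals.
Context {R : realType}.
Implicit Types (a b : R) (f g : R -> R).
Local Notation mu := (@lebesgue_measure R).

Lemma continuous_integrable_cc a b f : continuous f ->
  mu.-integrable `[a, b] (EFin \o f).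
Proof.
move=> cf; apply: continuous_compact_integrable; first exact: segment_compact.
exact: continuous_subspaceT.
Qed.

Lemma EFin_Rintegral_cc a b f : continuous f ->
  ((\int[mu]_(x in `[a, b]) f x)%:E = \int[mu]_(x in `[a, b]) (f x)%:E)%E.
Proof.
move=> cf; rewrite /Rintegral fineK//; apply: integrable_fin_num => //.
exact: continuous_integrable_cc.
Qed.

Lemma Rintegral_cc_cst a b (c : R) : a <= b ->
  \int[mu]_(_ in `[a, b]) c = c * (b - a).
Proof.
move=> ab; rewrite Rintegral_cst//=; congr (_ * _).
have -> := lebesgue_measure_itv `[a, b].
by rewrite /= lte_fin; case: ltgtP ab => // ->; rewrite subrr.
Qed.

(** The derivative is asked for on the open interval only, because derivatives in [x_3] will be
    two-sided only between the walls. *)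
Lemma Rintegral_FTC2 a b f (F : R -> R) : a < b -> continuous f ->
  {within `[a, b], continuous F} ->
  (forall x, x \in `]a, b[ -> is_derive x 1 F (f x)) ->
  \int[mu]_(x in `[a, b]) f x = F b - F a.
Proof.
move=> ab cf /(continuous_within_itvP _ ab)[_ Fa Fb] dF.
rewrite /Rintegral (@continuous_FTC2 _ f F a b)//.
- exact: continuous_subspaceT.
- by split => // x /dF [].
- by move=> x /dF d; rewrite derive1E; exact: derive_val.
Qed.

Lemma is_derive_Rintegral_ub a f x : continuous f -> a < x ->
  is_derive x 1 (fun z => \int[mu]_(t in `[a, z]) f t) (f x).
Proof.
move=> cf ax; have xx1 : x < x + 1 by rewrite ltrDl.
have := @continuous_FTC1_closed R f a x (x + 1) xx1
  (@continuous_integrable_cc a (x + 1) f cf) ax (cf x).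
by rewrite derive1E => -[dF F'x]; apply: DeriveDef.
Qed.

(** The primitive [F] is nondecreasing and zero at [b], hence zero on all of [[a, b]]. If [f] were
    positive somewhere, the mean value theorem on a short interval there would give [F] a nonzero
    increment. *)
Lemma Rintegral_eq0 a b f : a < b -> continuous f ->
  (forall x, x \in `[a, b] -> 0 <= f x) ->
  \int[mu]_(x in `[a, b]) f x = 0 ->
  forall x, x \in `[a, b] -> f x = 0.
Proof.
move=> ab cf f0 If0.
pose F x := \int[mu]_(t in `[a, x]) f t.
have mvt p q : a <= p -> p < q -> q <= b ->
    exists2 c, c \in `]p, q[ & F q - F p = f c * (q - p).
  move=> ap pq qb; apply: MVT => //.
    move=> x /[!in_itv]/= /andP[px xq]; apply: is_derive_Rintegral_ub => //.
    exact: le_lt_trans px.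
  apply: (@continuous_subspaceW _ _ _ `[a, b]).
    by apply: subset_itvScc; rewrite bnd_simp.
  apply: parameterized_integral_continuous; first exact: ltW.
  exact: continuous_integrable_cc.
(* [F p] is nonnegative as an integral, and nonpositive since [F] grows from [p] to [b], where it is
   zero. *)
have F0 p : a <= p -> p <= b -> F p = 0.
  move=> ap; rewrite le_eqVlt => /predU1P[->//|pb].
  apply/eqP; rewrite eq_le Rintegral_ge0 ?andbT.
    have [c /[!in_itv]/= /andP[pc cb]] := mvt _ _ ap pb (lexx b).
    rewrite {1}/F If0 sub0r => /eqP; rewrite eqr_oppLR => /eqP ->.
    rewrite oppr_le0; apply: mulr_ge0; last by rewrite subr_ge0 ltW.
    apply: f0; rewrite in_itv/=.
    by rewrite (ltW cb) (le_trans ap (ltW pc)).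
  move=> x /= /[!in_itv]/= /andP[ax xp]; apply: f0.
  by rewrite in_itv/= ax (le_trans xp (ltW pb)).
move=> x xab; have := xab; rewrite in_itv/= => /andP[ax xb].
apply/eqP; rewrite eq_le f0// andbT leNgt; apply/negP => fx0.
have /cvgr_gt /(_ _ fx0) [e /= e0 fe] := cf x.
(* Clipping to [[a, b]] keeps the interval nondegenerate even when [x] is an endpoint; on it [f]
   stays positive. *)
pose p := Num.max a (x - e / 2); pose q := Num.min b (x + e / 2).
have pq : p < q.
  by rewrite /p /q lt_min !gt_max; apply/andP; split; apply/andP; split; lra.
have ap : a <= p by rewrite le_max lexx.
have qb : q <= b by rewrite ge_min lexx.
have [c /[!in_itv]/= /andP[pc cq]] := mvt p q ap pq qb.
rewrite !F0 ?subrr//; [|exact: le_trans (ltW pq) _|exact: le_trans (ltW pq)].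
move=> /esym/eqP.
rewrite mulf_eq0 [q - p == 0]subr_eq0 (gt_eqF pq) orbF gt_eqF//.
apply: fe => /=; move: pc cq.
rewrite /p /q gt_max lt_min => /andP[_ pc] /andP[_ cq].
by rewrite ltr_distlC; apply/andP; split; lra.
Qed.

Section parameter_space.
Variables (T : topologicalType) (a b : R) (G : T -> R -> R).
Hypothesis cG : continuous (fun p : T * R => G p.1 p.2).

Lemma continuous_section p : continuous (G p).
Proof.
move=> y; apply: (continuous_comp (f := fun y => (p, y))
  (g := fun p : T * R => G p.1 p.2)); last exact: cG.
by apply: continuous_pair => // z; [exact: cst_continuous|exact: cvg_id].
Qed.

(** Tube lemma: each [y] has a neighbourhood on which joint continuity gives the estimate for
    parameters near [p0], and compactness of the segment makes the choice uniform in [y]. *)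
Lemma near_uniform_segment p0 (e : R) : 0 < e ->
  \forall p \near p0, forall y, y \in `[a, b] -> `|G p y - G p0 y| < e.
Proof.
move=> e0; have /compact_near_coveringP := @segment_compact R a b.
move=> /(_ T (nbhs p0) (fun p y => `|G p y - G p0 y| < e) _); apply => y yab.
have e20 : 0 < e / 2 by rewrite divr_gt0.
have h1 : \forall z \near (y, p0), `|G p0 y - G z.2 z.1| < e / 2.
  have H : {for (y, p0), continuous (fun z : R * T => G z.2 z.1)}.
    apply: (continuous_comp (f := fun z : R * T => (z.2, z.1))
      (g := fun p : T * R => G p.1 p.2)); last exact: cG.
    by apply: continuous_pair => z; [exact: cvg_snd|exact: cvg_fst].
  by move/cvgrPdist_lt: H => /(_ _ e20).
have h2 : \forall z \near (y, p0), `|G p0 y - G p0 z.1| < e / 2.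
  have H : {for (y, p0), continuous (fun z : R * T => G p0 z.1)}.
    apply: (continuous_comp (f := @fst R T)); last exact: continuous_section.
    exact: cvg_fst.
  by move/cvgrPdist_lt: H => /(_ _ e20).
near=> z.
rewrite (_ : _ - _ = (G p0 y - G p0 z.1) - (G p0 y - G z.2 z.1)); last by ring.
rewrite (le_lt_trans (ler_normB _ _))// (splitr e) ltrD//.
  by near: z.
by near: z.
Unshelve. all: by end_near. Qed.

Lemma continuous_Rintegral : a <= b ->
  continuous (fun p => \int[mu]_(y in `[a, b]) G p y).
Proof.
move=> ab p0.
apply/cvgrPdist_le => e e0.
(* The [+ 1] keeps the denominator positive when [a = b]. *)
have d0 : 0 < e / (b - a + 1) by rewrite divr_gt0// ltr_wpDl// subr_ge0.
near=> p.
have ci q : continuous (G q) by exact: continuous_section.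
rewrite -RintegralB//; [|exact: continuous_integrable_cc..].
apply: le_trans (le_normr_Rintegral _ _) _ => //.
  apply: (@continuous_integrable_cc a b (fun y => G p0 y - G p y)) => y.
  by apply: cvgB; exact: ci.
apply: (@le_trans _ _ (\int[mu]_(y in `[a, b]) (e / (b - a + 1)))).
  apply: le_Rintegral => //.
  - apply: (@continuous_integrable_cc a b (fun y => `|G p0 y - G p y|)) => y.
    by apply: cvg_norm; apply: cvgB; exact: ci.
  - by apply: continuous_integrable_cc; exact: cst_continuous.
  - move=> y yab; rewrite distrC; apply: ltW.
    by move: y yab; near: p; exact: near_uniform_segment.
rewrite Rintegral_cc_cst// mulrAC ler_pdivrMr ?ltr_wpDl ?subr_ge0//.
by rewrite ler_pM2l// lerDl.
Unshelve. all: by end_near. Qed.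

End parameter_space.

Lemma is_derive_Rintegral a b (G Gt : R -> R -> R) (t : R) :
  continuous (fun p : R * R => G p.1 p.2) ->
  continuous (fun p : R * R => Gt p.1 p.2) ->
  (forall s y : R, y \in `[a, b] -> is_derive s 1 (G^~ y) (Gt s y)) ->
  is_derive t 1 (fun s => \int[mu]_(y in `[a, b]) G s y)
    (\int[mu]_(y in `[a, b]) Gt t y).
Proof.
move=> cG cGt dG.
have G'E s y : y \in `[a, b] -> partial1of2 G s y = Gt s y.
  by move=> /(dG s) ?; rewrite partial1of2E; exact: derive_val.
(* Tolerance 1 yields a time window around [t] in which [Gt s y] is dominated by the integrable
   function [|Gt t y| + 1], as differentiation under the integral requires. *)
have /(near_uniform_segment a b)/(_ t _ ltr01)[e /= e0 te] := cGt.
have tI : `]t - e, t + e[%classic t.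
  by rewrite /= in_itv/= ltrBlDr ltrDl e0.
have intG (s : R) : `]t - e, t + e[%classic s ->
    mu.-integrable `[a, b] (EFin \o G s).
  by move=> _; apply: continuous_integrable_cc; exact: continuous_section.
have derG (s y : R) : `]t - e, t + e[%classic s -> `[a, b]%classic y ->
    derivable (G^~ y) s 1.
  by move=> _ yab; have [] := dG s y yab.
have intb : mu.-integrable `[a, b] (EFin \o (fun y => `|Gt t y| + 1)).
  apply: continuous_integrable_cc => y; apply: cvgD; last exact: cvg_cst.
  by apply: cvg_norm; exact: continuous_section.
have b0 y : 0 <= `|Gt t y| + 1 by rewrite addr_ge0.
have ubG (s y : R) : `]t - e, t + e[%classic s -> `[a, b]%classic y ->
    `|partial1of2 G s y| <= `|Gt t y| + 1.
  rewrite /= => /[!in_itv]/= /andP[ts st] yab; rewrite G'E//.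
  have /te/(_ y yab) h : ball t e s.
    by rewrite /ball/= ltr_distlC; apply/andP; split.
  rewrite -(subrK (Gt t y) (Gt s y)) addrC.
  by rewrite (le_trans (ler_normD _ _))// lerD2l ltW.
apply: DeriveDef.
  exact: (derivable_under_integral (mu := mu) _ tI intG derG b0 intb ubG).
rewrite -derive1E.
rewrite (differentiation_under_integral (mu := mu) _ tI intG derG b0 intb
  ubG)//.
by apply: eq_Rintegral => y /[!inE] yab; rewrite G'E.
Qed.

(** [E] is nonincreasing, so a positive value [E t] bounds all earlier values from below and every
    earlier slope is at most [- k * E t]; going back far enough breaks the bound [M]. *)
Lemma decay_bounded_eq0 (E dE : R -> R) (k M : R) : 0 < k ->
  (forall t : R, is_derive t 1 E (dE t)) -> (forall t, dE t <= - k * E t) ->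
  (forall t, 0 <= E t <= M) -> forall t, E t = 0.
Proof.
move=> k0 dE_ dEle bE t; have [Et0 _] := andP (bE t).
have cE s : {for s, continuous E}.
  by apply: differentiable_continuous; apply/derivable1_diffP; have [] := dE_ s.
have mvt p q : p < q -> exists2 c, c \in `]p, q[ & E q - E p = dE c * (q - p).
  move=> pq; apply: MVT => //; exact: continuous_subspaceT.
have dec p q : p <= q -> E q <= E p.
  rewrite le_eqVlt => /predU1P[->//|pq].
  have [c _ Epq] := mvt _ _ pq; rewrite -subr_le0 Epq mulr_le0_ge0//.
    have [Ec0 _] := andP (bE c).
    by rewrite (le_trans (dEle c))// mulr_le0_ge0// oppr_le0 ltW.
  by rewrite subr_ge0 ltW.
apply/eqP; rewrite eq_le Et0 andbT leNgt; apply/negP => {}Et0.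
have ke0 : 0 < k * E t by rewrite mulr_gt0.
(* Over this time span the slope bound forces [E s >= E t + M + 1]. *)
pose s := t - (M + 1) / (k * E t).
have M0 : 0 <= M by have /andP[h1 h2] := bE t; exact: le_trans h1 h2.
have st : s < t by rewrite /s ltrBlDr ltrDl divr_gt0// ltr_wpDl.
have [c /[!in_itv]/= /andP[_ ct] Est] := mvt _ _ st.
have Ect : E t <= E c by apply/dec/ltW.
have : dE c * (t - s) <= - (k * E t) * (t - s).
  apply: ler_wpM2r; first by rewrite subr_ge0 ltW.
  apply: le_trans (dEle c) _.
  by rewrite mulNr lerN2 ler_wpM2l// ltW.
rewrite -Est {2}/s opprB addrCA subrr addr0 mulNr mulrC divfK ?gt_eqF//.
have /andP[_ EsM] := bE s.
by move=> ?; lra.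
Qed.

End parametric_integrals.

(** * Solutions of the heat equation on the whole time axis *)

Section heat_subsolution.
Context {R : realType}.
Local Notation mu := (@lebesgue_measure R).

(** The three arguments stand for [t], [x_2] and [x_3], in this order. *)
Definition jointly_continuous (G : R -> R -> R -> R) :=
  continuous (fun p : R * R * R => G p.1.1 p.1.2 p.2).

Lemma jointly_continuous_comp (T : topologicalType) G (f g k : T -> R) :
  jointly_continuous G -> continuous f -> continuous g -> continuous k ->
  continuous (fun p => G (f p) (g p) (k p)).
Proof.
move=> cG cf cg ck p.
apply: (continuous_comp (f := fun p => (f p, g p, k p))
  (g := fun p : R * R * R => G p.1.1 p.1.2 p.2)); last exact: cG.
by apply: continuous_pair => //; exact: continuous_pair.
Qed.

Lemma jointly_continuousD G H : jointly_continuous G -> jointly_continuous H ->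
  jointly_continuous (fun t x y => G t x y + H t x y).
Proof. by move=> cG cH p; apply: cvgD; [exact: cG|exact: cH]. Qed.

Lemma jointly_continuousB G H : jointly_continuous G -> jointly_continuous H ->
  jointly_continuous (fun t x y => G t x y - H t x y).
Proof. by move=> cG cH p; apply: cvgB; [exact: cG|exact: cH]. Qed.

Lemma jointly_continuousM G H : jointly_continuous G -> jointly_continuous H ->
  jointly_continuous (fun t x y => G t x y * H t x y).
Proof. by move=> cG cH p; apply: cvgM; [exact: cG|exact: cH]. Qed.

Lemma jointly_continuous_reflect G (h : R) : jointly_continuous G ->
  jointly_continuous (fun t x y => G t x (h - y)).
Proof.
move=> cG; apply: (@jointly_continuous_comp _ G (fun p : R * R * R => p.1.1)
  (fun p => p.1.2) (fun p => h - p.2)) => // p.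
- exact: (continuous_comp (f := fst) (g := fst) (@cvg_fst _ _ _ _ _)
    (@cvg_fst _ _ _ _ _)).
- exact: (continuous_comp (f := fst) (g := snd) (@cvg_fst _ _ _ _ _)
    (@cvg_snd _ _ _ _ _)).
- by apply: cvgB; [exact: cvg_cst|exact: cvg_snd].
Qed.

Lemma jointly_continuous_snd (f : R -> R) : continuous f ->
  jointly_continuous (fun _ _ y => f y).
Proof.
move=> cf p; apply: (continuous_comp (f := snd)); last exact: cf.
exact: cvg_snd.
Qed.

Lemma jointly_continuous_section G t x :
  jointly_continuous G -> continuous (G t x).
Proof.
move=> cG; apply: (@jointly_continuous_comp _ G (cst t) (cst x) id) => // y.
- exact: cst_continuous.
- exact: cst_continuous.
- exact: cvg_id.
Qed.

Lemma jointly_continuous_section1 G t : jointly_continuous G ->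
  continuous (fun p : R * R => G t p.1 p.2).
Proof.
move=> cG; apply: (@jointly_continuous_comp _ G (cst t) fst snd) => // p.
- exact: cst_continuous.
- exact: cvg_fst.
- exact: cvg_snd.
Qed.

Lemma jointly_continuous_section2 G x : jointly_continuous G ->
  continuous (fun p : R * R => G p.1 x p.2).
Proof.
move=> cG; apply: (@jointly_continuous_comp _ G fst (cst x) snd) => // p.
- exact: cvg_fst.
- exact: cst_continuous.
- exact: cvg_snd.
Qed.

Variables (nu h L M : R) (G Gt Gx Gxx Gy Gyy : R -> R -> R -> R).
Hypotheses (nu_gt0 : 0 < nu) (h_gt0 : 0 < h) (L_gt0 : 0 < L).
Hypotheses (cG : jointly_continuous G) (cGt : jointly_continuous Gt)
  (cGx : jointly_continuous Gx) (cGxx : jointly_continuous Gxx)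
  (cGy : jointly_continuous Gy) (cGyy : jointly_continuous Gyy).
(** Time and [x] are tangent to the walls, so derivatives in these directions are available up to
    the walls; those in [y] are taken strictly inside. *)
Hypothesis dGt : forall t x y : R, y \in `[0, h] ->
  is_derive t 1 (fun s => G s x y) (Gt t x y).
Hypothesis dGxx : forall t x y : R, y \in `[0, h] ->
  is_derive x 1 (fun s => Gx t s y) (Gxx t x y).
Hypothesis dGy : forall t x y : R, y \in `]0, h[ ->
  is_derive y 1 (G t x) (Gy t x y).
Hypothesis dGyy : forall t x y : R, y \in `]0, h[ ->
  is_derive y 1 (Gy t x) (Gyy t x y).
Hypothesis G_ge0 : forall t x y : R, y \in `[0, h] -> 0 <= G t x y.
Hypothesis G_wall : forall t x, G t x 0 = 0 /\ G t x h = 0.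
Hypothesis Gx_periodic : forall t y : R, y \in `[0, h] -> Gx t L y = Gx t 0 y.
Hypothesis G_sub : forall t x y : R, y \in `]0, h[ ->
  Gt t x y <= nu * (Gxx t x y + Gyy t x y).
Hypothesis G_bounded : forall t,
  \int[mu]_(x in `[0, L]) \int[mu]_(y in `[0, h]) G t x y <= M.

(** A polynomial substitute for the first Dirichlet eigenfunction [sin (pi y / h)]: zero at both
    walls, positive and concave between them. *)
Let w (y : R) : R := y * (h - y).

Let cw : continuous w.
Proof. by move=> y; apply: cvgM => //; apply: cvgB => //; exact: cvg_cst. Qed.

Let w_ge0 (y : R) : y \in `[0, h] -> 0 <= w y.
Proof. by rewrite in_itv/= => /andP[? ?]; rewrite mulr_ge0// subr_ge0. Qed.

(** The maximum is at [y = h / 2], as completing the square shows. The bound fixes the decay rate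
    and also controls the weighted energy by the unweighted one. *)
Let w_le y : w y <= h ^+ 2 / 4.
Proof.
rewrite -subr_ge0 /w (_ : _ - _ = (y - h / 2) ^+ 2); last by field.
exact: sqr_ge0.
Qed.

Let wint (H : R -> R -> R -> R) t x := \int[mu]_(y in `[0, h]) (H t x y * w y).

Let cw3 : jointly_continuous (fun _ _ y => w y).
Proof. exact: jointly_continuous_snd. Qed.

Let wint_continuous H : jointly_continuous H ->
  continuous (fun p : R * R => wint H p.1 p.2).
Proof.
move=> cH; apply: (@continuous_Rintegral R (R * R)%type 0 h
  (fun p y => H p.1 p.2 y * w y)); last exact: ltW.
exact: (jointly_continuousM cH cw3).
Qed.

Let int_section H t x : jointly_continuous H ->
  mu.-integrable `[0, h] (EFin \o H t x).
Proof.
move=> cH; apply: continuous_integrable_cc.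
exact: jointly_continuous_section.
Qed.

Let is_derive_mulw (f : R -> R) (x df c : R) : is_derive x 1 f df ->
  is_derive x 1 (fun s => f s * c) (df * c).
Proof.
move=> d; have := is_derive_mulf d (is_derive_cst c x 1).
by rewrite mulr0 add0r mulrC.
Qed.

Let wint_derive_t (t x : R) : is_derive t 1 (fun s => wint G s x) (wint Gt t x).
Proof.
have c1 := jointly_continuous_section2 (x := x) (jointly_continuousM cG cw3).
have c2 := jointly_continuous_section2 (x := x) (jointly_continuousM cGt cw3).
have d (s y : R) : y \in `[0, h] ->
    is_derive s 1 (fun s => G s x y * w y) (Gt s x y * w y).
  by move=> y0h; exact: (is_derive_mulw (w y) (dGt s x y0h)).
exact: (@is_derive_Rintegral R 0 h (fun s y => G s x y * w y)
  (fun s y => Gt s x y * w y) t c1 c2 d).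
Qed.

Let wint_derive_x H H' (t x : R) :
  jointly_continuous H -> jointly_continuous H' ->
  (forall s y : R, y \in `[0, h] ->
    is_derive s 1 (fun x => H t x y) (H' t s y)) ->
  is_derive x 1 (wint H t) (wint H' t x).
Proof.
move=> cH cH' dH.
have c1 := jointly_continuous_section1 (t := t) (jointly_continuousM cH cw3).
have c2 := jointly_continuous_section1 (t := t) (jointly_continuousM cH' cw3).
have d (s y : R) : y \in `[0, h] ->
    is_derive s 1 (fun s => H t s y * w y) (H' t s y * w y).
  by move=> y0h; exact: (is_derive_mulw (w y) (dH s y y0h)).
exact: (@is_derive_Rintegral R 0 h (fun s y => H t s y * w y)
  (fun s y => H' t s y * w y) x c1 c2 d).
Qed.

(* [Gy w - G w'] vanishes at both walls, and [w'' = - 2]. *)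
Let wint_Gyy t x : wint Gyy t x = - 2 * \int[mu]_(y in `[0, h]) G t x y.
Proof.
have cG2 : continuous (fun y => 2 * G t x y).
  by move=> y; apply: cvgM; [exact: cvg_cst|exact: jointly_continuous_section].
have cGw : continuous (fun y => Gyy t x y * w y).
  exact: (jointly_continuous_section (t := t) (x := x)
    (jointly_continuousM cGyy cw3)).
suff : \int[mu]_(y in `[0, h]) (Gyy t x y * w y + 2 * G t x y) = 0.
  rewrite RintegralD//; [|exact: continuous_integrable_cc..].
  rewrite RintegralZl//; last exact: int_section.
  by move/eqP; rewrite addr_eq0 -mulNr => /eqP.
pose N y := Gy t x y * w y - G t x y * (h - 2 * y).
have cN : continuous N.
  move=> y; apply: cvgB; apply: cvgM.
  - exact: jointly_continuous_section.
  - exact: cw.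
  - exact: jointly_continuous_section.
  - apply: cvgB; first exact: cvg_cst.
    by apply: cvgM; [exact: cvg_cst|exact: cvg_id].
have dN y : y \in `]0, h[ ->
    is_derive y 1 N (Gyy t x y * w y + 2 * G t x y).
  move=> y0h; have d1 := dGy t x y0h; have d2 := dGyy t x y0h.
  have dl : is_derive y 1 (fun y => h - 2 * y) (- 2).
    have := is_derive_mulf (is_derive_cst (2 : R) y 1) (is_derive_id y (1 : R)).
    rewrite mulr0 addr0 mulr1 => /(is_deriveB (is_derive_cst h y 1)).
    by rewrite sub0r.
  have dw : is_derive y 1 w (h - 2 * y).
    have dh := is_deriveB (is_derive_cst h y 1) (is_derive_id y (1 : R)).
    have e : y * (0 - 1) + (h - y) * 1 = h - 2 * y by ring.
    exact: (is_derive_eq (is_derive_mulf (is_derive_id y (1 : R)) dh) e).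
  have e : Gy t x y * (h - 2 * y) + w y * Gyy t x y -
      (G t x y * - 2 + (h - 2 * y) * Gy t x y) =
      Gyy t x y * w y + 2 * G t x y by ring.
  exact: (is_derive_eq (is_deriveB (is_derive_mulf d2 dw)
    (is_derive_mulf d1 dl)) e).
have cf : continuous (fun y => Gyy t x y * w y + 2 * G t x y).
  by move=> y; apply: cvgD; [exact: cGw|exact: cG2].
have [G0 Gh] := G_wall t x.
have := Rintegral_FTC2 h_gt0 cf (continuous_subspaceT cN) dN.
by move=> ->; rewrite /N /w G0 Gh subrr !(mul0r, mulr0) !subrr.
Qed.

(** The differential inequality is integrated against [w]. The [y]-part becomes [- 2] times the
    integral of [G], which [w_le] compares with the weighted integral. *)
Let wint_Gt t x :
  wint Gt t x <= nu * wint Gxx t x - 8 * nu / h ^+ 2 * wint G t x.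
Proof.
have cW H : jointly_continuous H -> continuous (fun y => H t x y * w y).
  by move=> cH; exact: (jointly_continuous_section (t := t) (x := x)
    (jointly_continuousM cH cw3)).
have iW H : jointly_continuous H ->
    mu.-integrable `[0, h] (EFin \o (fun y => H t x y * w y)).
  by move=> cH; exact/continuous_integrable_cc/cW.
(* The factor 8 is the 2 from [wint_Gyy] times the 4 from [w_le]. *)
have -> : 8 * nu / h ^+ 2 * wint G t x =
    nu * (2 * (4 / h ^+ 2 * wint G t x)) by ring.
have wG : 4 / h ^+ 2 * wint G t x <= \int[mu]_(y in `[0, h]) G t x y.
  rewrite -RintegralZl//; last exact: iW.
  apply: le_Rintegral => //.
  - apply: continuous_integrable_cc => y.
    by apply: cvgM; [exact: cvg_cst|exact: cW].
  - exact: int_section.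
  - move=> y y0h; rewrite mulrCA ler_piMr ?G_ge0//.
    by rewrite mulrAC ler_pdivrMr ?exprn_gt0// mul1r -ler_pdivlMl// mulrC w_le.
rewrite -mulrBr; apply: (@le_trans _ _ (nu * (wint Gxx t x + wint Gyy t x))).
  rewrite -RintegralD//; [|exact: iW..].
  rewrite -RintegralZl//; last first.
    apply: continuous_integrable_cc => y.
    by apply: cvgD; exact: cW.
  apply: le_Rintegral => //.
  - exact: iW.
  - apply: continuous_integrable_cc => y; apply: cvgM; first exact: cvg_cst.
    by apply: cvgD; exact: cW.
  - move=> y y0h; rewrite -mulrDl mulrA.
    have := y0h; rewrite /= in_itv/= => /andP[].
    rewrite le_eqVlt => /predU1P[<- _|y0]; first by rewrite /w mul0r !mulr0.
    rewrite le_eqVlt => /predU1P[->|yh]; first by rewrite /w subrr !mulr0.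
    by apply: ler_wpM2r; [exact: w_ge0|apply: G_sub; rewrite in_itv/= y0].
by rewrite ler_pM2l// wint_Gyy mulNr lerD2l lerN2 ler_pM2l.
Qed.

Let E t := \int[mu]_(x in `[0, L]) wint G t x.

Let swint_continuous H t : jointly_continuous H -> continuous (wint H t).
Proof.
move=> cH; apply: (@continuous_section R R (wint H)).
exact: wint_continuous.
Qed.

Let swint_integrable H t : jointly_continuous H ->
  mu.-integrable `[0, L] (EFin \o wint H t).
Proof. by move=> cH; exact/continuous_integrable_cc/swint_continuous. Qed.

Let dE (t : R) : is_derive t 1 E (\int[mu]_(x in `[0, L]) wint Gt t x).
Proof.
exact: (@is_derive_Rintegral R 0 L (wint G) (wint Gt) t
  (wint_continuous cG) (wint_continuous cGt)
  (fun s x _ => wint_derive_t s x)).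
Qed.

Let E_decay t :
  \int[mu]_(x in `[0, L]) wint Gt t x <= - (8 * nu / h ^+ 2) * E t.
Proof.
(* Integrating in [x] leaves the increment of [wint Gx t] over one period, which is zero. *)
have Gxx0 : \int[mu]_(x in `[0, L]) wint Gxx t x = 0.
  have d (x : R) : x \in `]0, L[ -> is_derive x 1 (wint Gx t) (wint Gxx t x).
    by move=> _; exact: (wint_derive_x x cGx cGxx (fun s y => @dGxx t s y)).
  have := Rintegral_FTC2 L_gt0 (swint_continuous (t := t) cGxx)
    (continuous_subspaceT (swint_continuous (t := t) cGx)) d.
  move=> ->; rewrite /wint; apply/eqP; rewrite subr_eq0; apply/eqP.
  by apply: eq_Rintegral => y; rewrite inE => y0h; rewrite Gx_periodic.
have c1 : continuous (fun x => nu * wint Gxx t x).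
  by move=> x; apply: cvgM; [exact: cvg_cst|exact: swint_continuous].
have c2 : continuous (fun x => 8 * nu / h ^+ 2 * wint G t x).
  by move=> x; apply: cvgM; [exact: cvg_cst|exact: swint_continuous].
apply: (@le_trans _ _ (\int[mu]_(x in `[0, L])
    (nu * wint Gxx t x - 8 * nu / h ^+ 2 * wint G t x))).
  apply: le_Rintegral => //; first exact: swint_integrable.
  apply: continuous_integrable_cc => x.
  by apply: cvgB; [exact: c1|exact: c2].
rewrite RintegralB//; [|exact: continuous_integrable_cc..].
rewrite !RintegralZl//; [|exact: swint_integrable..].
by rewrite Gxx0 mulr0 sub0r mulNr.
Qed.

Let wint_ge0 t x : 0 <= wint G t x.
Proof.
by apply: Rintegral_ge0 => y y0h; rewrite mulr_ge0 ?w_ge0 ?G_ge0.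
Qed.

Let E_bounded t : 0 <= E t <= h ^+ 2 / 4 * M.
Proof.
rewrite Rintegral_ge0//=.
have cI : continuous (fun x => \int[mu]_(y in `[0, h]) G t x y).
  apply: (@continuous_Rintegral R R 0 h (G t)); last exact: ltW.
  exact: jointly_continuous_section1.
have h0 : 0 <= h ^+ 2 / 4 by rewrite divr_ge0 ?sqr_ge0.
apply: le_trans (ler_wpM2l h0 (G_bounded t)).
rewrite -RintegralZl//; last exact: continuous_integrable_cc.
apply: le_Rintegral => //.
- exact: swint_integrable.
- apply: continuous_integrable_cc => x.
  by apply: cvgM; [exact: cvg_cst|exact: cI].
- move=> x _; rewrite -RintegralZl//; last exact: int_section.
  apply: le_Rintegral => //.
  + apply: continuous_integrable_cc.
    exact: (jointly_continuous_section (t := t) (x := x)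
      (jointly_continuousM cG cw3)).
  + apply: continuous_integrable_cc => y.
    by apply: cvgM; [exact: cvg_cst|exact: jointly_continuous_section].
  + by move=> y y0h; rewrite mulrC ler_wpM2r ?G_ge0 ?w_le.
Qed.

(** Decay and boundedness make [E] vanish; nonnegativity of the integrands then removes the two
    integrals in turn. The final division by [w] takes place off the walls. *)
Lemma heat_subsolution_eq0 (t x y : R) : x \in `[0, L] -> y \in `]0, h[ ->
  G t x y = 0.
Proof.
move=> x0L y0h.
have k0 : 0 < 8 * nu / h ^+ 2 by rewrite divr_gt0 ?exprn_gt0// mulr_gt0.
have E0 := decay_bounded_eq0 k0 dE E_decay E_bounded t.
have wG0 : wint G t x = 0.
  by apply: (Rintegral_eq0 L_gt0 _ _ E0) => //; exact: swint_continuous.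
have /eqP : G t x y * w y = 0.
  apply: (Rintegral_eq0 h_gt0 _ _ wG0).
  - exact: (jointly_continuous_section (t := t) (x := x)
      (jointly_continuousM cG cw3)).
  - by move=> z z0h; rewrite mulr_ge0 ?w_ge0 ?G_ge0.
  - exact: subset_itv_oo_cc.
have /andP[y0 yh] : 0 < y < h by move: y0h; rewrite in_itv.
by rewrite mulf_eq0 [w y == 0]gt_eqF ?orbF ?mulr_gt0 ?subr_gt0// => /eqP.
Qed.

End heat_subsolution.

(** * Heat solutions through their squares *)

Section bounded_heat_solution.
Context {R : realType}.
Local Notation mu := (@lebesgue_measure R).
Variables (nu h L M : R) (Z Zt Zx Zxx Zy Zyy : R -> R -> R -> R).
Hypotheses (nu_gt0 : 0 < nu) (h_gt0 : 0 < h) (L_gt0 : 0 < L).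
Hypotheses (cZ : jointly_continuous Z) (cZt : jointly_continuous Zt)
  (cZx : jointly_continuous Zx) (cZxx : jointly_continuous Zxx)
  (cZy : jointly_continuous Zy) (cZyy : jointly_continuous Zyy).
Hypothesis dZt : forall t x y : R, y \in `[0, h] ->
  is_derive t 1 (fun s => Z s x y) (Zt t x y).
Hypothesis dZx : forall t x y : R, y \in `[0, h] ->
  is_derive x 1 (fun s => Z t s y) (Zx t x y).
Hypothesis dZxx : forall t x y : R, y \in `[0, h] ->
  is_derive x 1 (fun s => Zx t s y) (Zxx t x y).
Hypothesis dZy : forall t x y : R, y \in `]0, h[ ->
  is_derive y 1 (Z t x) (Zy t x y).
Hypothesis dZyy : forall t x y : R, y \in `]0, h[ ->
  is_derive y 1 (Zy t x) (Zyy t x y).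
Hypothesis Z_wall : forall t x, Z t x 0 = 0 /\ Z t x h = 0.
Hypothesis Z_periodic : forall t x y : R, y \in `[0, h] ->
  Z t (x + L) y = Z t x y.
Hypothesis Z_heat : forall t x y : R, y \in `]0, h[ ->
  Zt t x y = nu * (Zxx t x y + Zyy t x y).
Hypothesis Z_bounded : forall t,
  \int[mu]_(x in `[0, L]) \int[mu]_(y in `[0, h]) (Z t x y * Z t x y) <= M.

Lemma bounded_heat_solution_eq0 (t x y : R) : x \in `[0, L] -> y \in `]0, h[ ->
  Z t x y = 0.
Proof.
move=> x0L y0h.
have dd (f f' f'' : R -> R) (s : R) : is_derive s 1 f (f' s) ->
    is_derive s 1 f' (f'' s) ->
    is_derive s 1 (fun z => f z * f' z + f z * f' z)
      (f s * f'' s + f' s * f' s + (f s * f'' s + f' s * f' s)).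
  move=> d1 d2.
  exact: (is_deriveD (is_derive_mulf d1 d2) (is_derive_mulf d1 d2)).
have cM := @jointly_continuousM R.
(* Periodicity passes to the derivative because the difference quotients at [L] and at [0]
   coincide. *)
have Zx_periodic (s z : R) : z \in `[0, h] -> Zx s L z = Zx s 0 z.
  move=> z0h; have [_ <-] := @dZx s L z z0h; have [_ <-] := @dZx s 0 z z0h.
  rewrite /derive; congr (lim (_ @ 0^')); apply/funext => r /=.
  by rewrite Z_periodic// addr0 -(add0r L) Z_periodic.
suff /eqP : Z t x y * Z t x y = 0 by rewrite mulf_eq0 orbb => /eqP.
(* The derivatives of the square are kept as sums of two equal halves, the shape in which the
   product rule delivers them. *)
pose G s r z := Z s r z * Z s r z.
pose Gt s r z := Z s r z * Zt s r z + Z s r z * Zt s r z.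
pose Gx s r z := Z s r z * Zx s r z + Z s r z * Zx s r z.
pose Gxx s r z := Z s r z * Zxx s r z + Zx s r z * Zx s r z +
  (Z s r z * Zxx s r z + Zx s r z * Zx s r z).
pose Gy s r z := Z s r z * Zy s r z + Z s r z * Zy s r z.
pose Gyy s r z := Z s r z * Zyy s r z + Zy s r z * Zy s r z +
  (Z s r z * Zyy s r z + Zy s r z * Zy s r z).
have cG : jointly_continuous G by exact: cM.
have cGt : jointly_continuous Gt by apply: jointly_continuousD; exact: cM.
have cGx : jointly_continuous Gx by apply: jointly_continuousD; exact: cM.
have cGxx : jointly_continuous Gxx.
  by apply: jointly_continuousD; apply: jointly_continuousD; exact: cM.
have cGy : jointly_continuous Gy by apply: jointly_continuousD; exact: cM.
have cGyy : jointly_continuous Gyy.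
  by apply: jointly_continuousD; apply: jointly_continuousD; exact: cM.
have dGt (s r z : R) : z \in `[0, h] ->
    is_derive s 1 (fun s => G s r z) (Gt s r z).
  by move=> z0h; exact: (is_derive_mulf (@dZt s r z z0h) (@dZt s r z z0h)).
have dGxx (s r z : R) : z \in `[0, h] ->
    is_derive r 1 (fun r => Gx s r z) (Gxx s r z).
  move=> z0h; exact: (dd (fun r => Z s r z) (fun r => Zx s r z)
    (fun r => Zxx s r z) r (@dZx s r z z0h) (@dZxx s r z z0h)).
have dGy (s r z : R) : z \in `]0, h[ -> is_derive z 1 (G s r) (Gy s r z).
  by move=> z0h; exact: (is_derive_mulf (@dZy s r z z0h) (@dZy s r z z0h)).
have dGyy (s r z : R) : z \in `]0, h[ -> is_derive z 1 (Gy s r) (Gyy s r z).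
  move=> z0h; exact: (dd (Z s r) (Zy s r) (Zyy s r) z
    (@dZy s r z z0h) (@dZyy s r z z0h)).
have G_ge0 (s r z : R) : z \in `[0, h] -> 0 <= G s r z.
  by move=> _; exact: sqr_ge0.
have G_wall s r : G s r 0 = 0 /\ G s r h = 0.
  by rewrite /G; have [-> ->] := Z_wall s r; rewrite mul0r.
have Gx_periodic (s z : R) : z \in `[0, h] -> Gx s L z = Gx s 0 z.
  by move=> z0h; rewrite /Gx Zx_periodic// -[in Z s L z](add0r L) Z_periodic.
(* The deficit in the inequality is the gradient term [2 nu (Z_x^2 + Z_y^2)]. *)
have G_sub (s r z : R) : z \in `]0, h[ ->
    Gt s r z <= nu * (Gxx s r z + Gyy s r z).
  move=> z0h; rewrite /Gt (@Z_heat s r z z0h) -subr_ge0 /Gxx /Gyy.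
  rewrite (_ : _ - _ = 2 * nu * (Zx s r z ^+ 2 + Zy s r z ^+ 2)); last by ring.
  by rewrite mulr_ge0 ?addr_ge0 ?sqr_ge0// mulr_ge0// ltW.
exact: (heat_subsolution_eq0 nu_gt0 h_gt0 L_gt0 cG cGt cGx cGxx cGy cGyy
  dGt dGxx dGy dGyy G_ge0 G_wall Gx_periodic G_sub Z_bounded t x0L y0h).
Qed.

End bounded_heat_solution.

(** * Restricted derivatives and ordinary derivatives *)

Section derive_in_interior.
Context {R : realType} {V W : normedModType R}.
Variables (D : set V) (a v : V).
Hypothesis Dav : \forall s \near (0 : R), D (s *: v + a).

(** When all small increments stay in [D], the restriction removes nothing near zero. The assumption
    concerns the direction [v] alone, so it also covers wall points in tangent directions. *)
Let increments_in_interior : increments_in D a v = 0^'.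
Proof.
apply/predeqP => A; split => [A0|]; last exact: cvg_within.
have Dn : \forall s \near 0^', D (s *: v + a) by exact: cvg_within.
move: A0; rewrite /increments_in /within /= => A0.
by near=> s; have Ds : D (s *: v + a) by [near: s]; move: Ds; near: s.
Unshelve. all: by end_near.
Qed.

Lemma is_derive_in (f : V -> W) : derivable_in D f a v ->
  is_derive a v f (derive_in D v f a).
Proof.
rewrite /derivable_in /derive_in increments_in_interior => df.
exact: DeriveDef.
Qed.

Lemma derive_in_interior (f : V -> W) : derive_in D v f a = 'D_v f a.
Proof. by rewrite /derive_in increments_in_interior. Qed.

End derive_in_interior.

Lemma is_derive_coord {R : realType} {V : normedModType R} {m n : nat}
    (f : V -> 'M[R]_(m, n)) (a v : V) df i j :
  is_derive a v f df -> is_derive a v (fun z => f z i j) (df i j).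
Proof.
move=> [dfa <-]; have /derivable_mxP dij := dfa.
by apply: DeriveDef; [exact: dij|rewrite derive_mx// mxE].
Qed.

(** Passes from a directional derivative in spacetime to a derivative in one real variable.
    Agreement near 0 is enough for the difference quotients, which matters for functions that are
    clamped at the walls. *)
Lemma is_derive_line {R : realType} {V : normedModType R} (f : V -> R)
    (phi : R -> R) (a v : V) (s df : R) : is_derive a v f df ->
  (\forall r \near 0, phi (r + s) = f (r *: v + a)) -> is_derive s 1 phi df.
Proof.
move=> [dfa <-] phiE.
have phis : phi s = f a.
  by have := nbhs_singleton phiE; rewrite add0r scale0r add0r.
have E : r^-1 *: ((phi \o shift s) (r *: 1) - phi s) @[r --> 0^'] =
         r^-1 *: ((f \o shift a) (r *: v) - f a) @[r --> 0^'].
  have e : \forall r \near 0^', r^-1 *: ((phi \o shift s) (r *: 1) - phi s) =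
      r^-1 *: ((f \o shift a) (r *: v) - f a).
    apply: (@cvg_within _ (nbhs 0)); apply: filterS phiE => r /= e.
    by rewrite [r *: 1]mulr1 e phis.
  rewrite eqEsubset; split; apply: near_eq_cvg => //.
  by apply: filterS e => r ->.
by apply: DeriveDef; rewrite /derivable /derive E.
Qed.


(** The primitives [H z] and [- H (h - z)] of the two integrands have the same increment over
    [[0, h]]. *)
Lemma Rintegral_reflect {R : realType} (h : R) (f : R -> R) : 0 < h ->
  continuous f -> \int[lebesgue_measure]_(y in `[0, h]) f (h - y) =
    \int[lebesgue_measure]_(y in `[0, h]) f y.
Proof.
move=> h0 cf.
(* Starting at [-1] makes [H] differentiable at 0 as well, since [is_derive_Rintegral_ub] requires a
   point strictly above the lower bound. *)
pose H z := \int[lebesgue_measure]_(y in `[-1, z]) f y.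
have dH z : z \in `[0, h] -> is_derive z 1 H (f z).
  rewrite in_itv/= => /andP[z0 _]; apply: is_derive_Rintegral_ub => //.
  by apply: lt_le_trans z0; rewrite ltrN10.
have dHr z : z \in `[0, h] -> is_derive z 1 (fun z => - H (h - z)) (f (h - z)).
  move=> z0h.
  have hz : h - z \in `[0, h].
    by move: z0h; rewrite !in_itv/= => /andP[? ?]; apply/andP; split; lra.
  have dl := is_deriveB (is_derive_cst h z 1) (is_derive_id z (1 : R)).
  have := is_deriveN (@is_derive1_comp _ H _ z _ _ (dH _ hz) dl).
  by rewrite sub0r mulrN1 opprK.
have cfr : continuous (fun y => f (h - y)).
  move=> y; apply: (continuous_comp (f := fun y => h - y)); last exact: cf.
  by apply: cvgB; [exact: cvg_cst|exact: cvg_id].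
have cH : {within `[0, h], continuous H}.
  by apply: derivable_within_continuous => z /dH[].
have cHr : {within `[0, h], continuous (fun z => - H (h - z))}.
  by apply: derivable_within_continuous => z /dHr[].
rewrite (Rintegral_FTC2 h0 cfr cHr
  (fun z z0h => dHr z (subset_itv_oo_cc z0h))).
rewrite (Rintegral_FTC2 h0 cf cH (fun z z0h => dH z (subset_itv_oo_cc z0h))).
by rewrite subrr subr0 opprK addrC.
Qed.

(** * Channel flows *)

Section channel_geometry.
Context {R : realType}.
Variable h : R.
Hypothesis h_gt0 : 0 < h.
Local Notation D := (channelT h).

Definition inside (z : spacetime R) : Prop := 0 < z.1 0 2 < h.

Lemma inside_channelT z : inside z -> D z.
Proof. by move=> /andP[z0 zh]; split => //=; rewrite /channel/= !ltW. Qed.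

Lemma near_inside (z v : spacetime R) : inside z ->
  \forall s \near (0 : R), inside (s *: v + z).
Proof.
move=> /andP[z0 zh].
have c : continuous (fun s : R => s * v.1 0 2 + z.1 0 2).
  move=> s; apply: cvgD; last exact: cvg_cst.
  by apply: cvgM; [exact: cvg_id|exact: cvg_cst].
have := c 0; rewrite /continuous_at mul0r add0r => c0.
near=> s; rewrite /inside /= !mxE; apply/andP; split; near: s.
- exact: (cvgr_gt _ c0).
- exact: (cvgr_lt _ c0).
Unshelve. all: by end_near. Qed.

Lemma near_channelT (z v : spacetime R) : inside z ->
  \forall s \near (0 : R), D (s *: v + z).
Proof. by move=> /(near_inside v); apply: filterS => s /inside_channelT. Qed.

Lemma near_channelT_tangent (z v : spacetime R) : D z -> v.1 0 2 = 0 ->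
  \forall s \near (0 : R), D (s *: v + z).
Proof.
move=> [zh _] v0; near=> s; split => //.
by rewrite /channel /= !mxE v0 mulr0 add0r.
Unshelve. all: by end_near. Qed.

Lemma sum_ord3 (V : nmodType) (F : 'I_3 -> V) :
  \sum_(i < 3) F i = F 0 + F 1 + F 2.
Proof.
rewrite !big_ord_recl big_ord0 addr0 addrA.
by congr (F _ + F _ + F _); exact: val_inj.
Qed.

Lemma sum_ord3_eq0 (V : nmodType) (F : 'I_3 -> V) :
  \sum_(i < 3) F i = 0 -> F 1 = 0 -> F 2 = 0 -> F 0 = 0.
Proof. by rewrite sum_ord3 => + F1 F2; rewrite F1 F2 !addr0. Qed.

(** * The momentum equation in components *)

Section momentum_equation.
Variables (nu : R) (ut v : 'rV[R]_3) (ux uxx : 'I_3 -> 'rV[R]_3).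
Variable (p : 'I_3 -> R).
Hypothesis momentum : ut + \sum_(i < 3) v 0 i *: ux i =
  nu *: (\sum_(i < 3) uxx i) - \row_(i < 3) p i.

Lemma momentum_transverse j : ut 0 j = 0 -> (forall i, ux i 0 j = 0) ->
  (forall i, uxx i 0 j = 0) -> p j = 0.
Proof.
move=> ut0 ux0 uxx0; have := congr1 (fun m : 'rV[R]_3 => m 0 j) momentum.
rewrite !sum_ord3 !mxE ut0 !ux0 !uxx0 !(mulr0, addr0) sub0r => /esym/eqP.
by rewrite oppr_eq0 => /eqP.
Qed.

(** The nonlinearity disappears: its only surviving candidate, [U] times the [x_1]-derivative of
    [U], is zero by [ux 0 0 0 = 0]. *)
Lemma momentum_streamwise : v 0 1 = 0 -> v 0 2 = 0 -> ux 0 0 0 = 0 ->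
  uxx 0 0 0 = 0 -> ut 0 0 = nu * (uxx 1 0 0 + uxx 2 0 0) - p 0.
Proof.
move=> v1 v2 ux0 uxx0; have := congr1 (fun m : 'rV[R]_3 => m 0 0) momentum.
by rewrite !sum_ord3 !mxE v1 v2 ux0 uxx0 !(mul0r, mulr0, addr0, add0r).
Qed.

End momentum_equation.

(** * Coordinates and profiles *)

Lemma vec3E (a b c : R) :
  (vec3 a b c 0 0 = a) * (vec3 a b c 0 1 = b) * (vec3 a b c 0 2 = c).
Proof. by rewrite !mxE. Qed.

Lemma shift_e_x0 (s a b c t : R) :
  s *: e_x R 0 + (vec3 a b c, t) = (vec3 (s + a) b c, t).
Proof.
apply: (f_equal2 pair); last by rewrite /= scaler0 add0r.
apply/rowP => -[[|[|[|//]]] i3]; rewrite !mxE /=.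
- by rewrite ?(mulr1, mulr0) ?add0r.
- by rewrite ?(mulr1, mulr0) ?add0r.
- by rewrite ?(mulr1, mulr0) ?add0r.
Qed.

Lemma shift_e_x1 (s a b c t : R) :
  s *: e_x R 1 + (vec3 a b c, t) = (vec3 a (s + b) c, t).
Proof.
apply: (f_equal2 pair); last by rewrite /= scaler0 add0r.
apply/rowP => -[[|[|[|//]]] i3]; rewrite !mxE /=.
- by rewrite ?(mulr1, mulr0) ?add0r.
- by rewrite ?(mulr1, mulr0) ?add0r.
- by rewrite ?(mulr1, mulr0) ?add0r.
Qed.

Lemma shift_e_x2 (s a b c t : R) :
  s *: e_x R 2 + (vec3 a b c, t) = (vec3 a b (s + c), t).
Proof.
apply: (f_equal2 pair); last by rewrite /= scaler0 add0r.
apply/rowP => -[[|[|[|//]]] i3]; rewrite !mxE /=.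
- by rewrite ?(mulr1, mulr0) ?add0r.
- by rewrite ?(mulr1, mulr0) ?add0r.
- by rewrite ?(mulr1, mulr0) ?add0r.
Qed.

Lemma shift_e_t (s t : R) x : s *: e_t R + (x, t) = (x, s + t).
Proof.
by apply: (f_equal2 pair); rewrite /= ?scaler0 ?add0r// [s *: 1]mulr1.
Qed.

(* Precomposing with [clamp] turns functions continuous on the channel only
   into functions continuous on the whole space. *)
Definition clamp (y : R) := Num.max 0 (Num.min y h).

Lemma clamp_id y : y \in `[0, h] -> clamp y = y.
Proof.
by rewrite in_itv/= /clamp => /andP[y0 /min_idPl ->]; exact/max_idPr.
Qed.

Lemma clamp_itv y : 0 <= clamp y <= h.
Proof. by rewrite /clamp le_max lexx/= ge_max (ltW h_gt0) ge_min lexx orbT. Qed.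

Lemma continuous_clamp : continuous clamp.
Proof.
move=> y.
have cmin : {for y, continuous (id \min (fun=> h) : R -> R^o)}.
  by apply: continuous_min; [exact: cvg_id|exact: cvg_cst].
by apply: (@continuous_max _ _ (fun=> 0 : R^o) _ y) cmin; exact: cvg_cst.
Qed.

(** The streamwise component with [x_1] frozen, extended past the walls by its wall values. It is
    applied to [u] and to its derivatives alike. *)
Definition profile (x1 : R) (g : spacetime R -> 'rV[R]_3) (t x y : R) : R :=
  g (vec3 x1 x (clamp y), t) 0 0.

Lemma vec3_channelT x1 x y t : D (vec3 x1 x (clamp y), t).
Proof. by split => //=; rewrite /channel/= vec3E clamp_itv. Qed.

Lemma continuous_vec3 (T : topologicalType) (f g k : T -> R) :
  continuous f -> continuous g -> continuous k ->
  continuous (fun p => vec3 (f p) (g p) (k p)).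
Proof.
move=> cf cg ck.
have -> : (fun p => vec3 (f p) (g p) (k p)) = fun p =>
    f p *: delta_mx 0 0 + g p *: delta_mx 0 1 + k p *: delta_mx 0 2.
  apply/funext => p; apply/rowP => -[[|[|[|//]]] i3]; rewrite !mxE /=.
  - by rewrite mulr1 !mulr0 !addr0.
  - by rewrite mulr1 !mulr0 addr0 add0r.
  - by rewrite mulr1 !mulr0 !add0r.
move=> p; apply: cvgD; [apply: cvgD|]; (apply: cvgZ; last exact: cvg_cst).
- exact: cf.
- exact: cg.
- exact: ck.
Qed.

Lemma continuous_profile x1 g : {within D, continuous g} ->
  jointly_continuous (profile x1 g).
Proof.
move=> /subspace_continuousP cg p.
pose z (q : R * R * R) : spacetime R := (vec3 x1 q.1.2 (clamp q.2), q.1.1).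
have cz : continuous z.
  apply: continuous_pair.
    apply: continuous_vec3 => q; first exact: cst_continuous.
      exact: (continuous_comp (f := fst) (g := snd) (@cvg_fst _ _ _ _ _)
        (@cvg_snd _ _ _ _ _)).
    exact: (continuous_comp (f := snd) (@cvg_snd _ _ _ _ _)
      (@continuous_clamp _)).
  move=> q.
  exact: (continuous_comp (f := fst) (g := fst) (@cvg_fst _ _ _ _ _)
    (@cvg_fst _ _ _ _ _)).
apply: (@continuous_comp _ _ _ (fun q => g (z q)) (fun m => m 0 0)); last first.
  exact: coord_continuous.
(* Clamping keeps [z] inside [D], so continuity of [g] within [D] suffices. *)
have zD q : D (z q) by exact: vec3_channelT.
apply: (cvg_comp z g _ (cg (z p) (zD p))) => A /(cz p) zA.
have : \forall q \near p, D (z q) -> A (z q) by exact: zA.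
by apply: filterS => q; apply; exact: zD.
Qed.

(** The direction is tangent to the walls, so the derivative is two-sided at every clamped point and
    [y] is unrestricted. *)
Lemma profile_derive_x x1 g (t x y : R) :
  (forall z, D z -> derivable_in D g z (e_x R 1)) ->
  is_derive x 1 (fun s => profile x1 g t s y) (profile x1 (d_x D 1 g) t x y).
Proof.
move=> dg; have Dz := vec3_channelT x1 x y t.
have nD : \forall s \near (0 : R),
    D (s *: e_x R 1 + (vec3 x1 x (clamp y), t)).
  by apply: near_channelT_tangent => //; rewrite !mxE.
have d := is_derive_coord 0 0 (is_derive_in nD (dg _ Dz)).
have e : \forall r \near (0 : R), profile x1 g t (r + x) y =
    g (r *: e_x R 1 + (vec3 x1 x (clamp y), t)) 0 0.
  by near=> r; rewrite shift_e_x1.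
exact: (is_derive_line (phi := fun s => profile x1 g t s y) d e).
Unshelve. all: by end_near. Qed.

Lemma profile_derive_t x1 g (t x y : R) :
  (forall z, D z -> derivable_in D g z (e_t R)) ->
  is_derive t 1 (fun s => profile x1 g s x y) (profile x1 (d_t D g) t x y).
Proof.
move=> dg; have Dz := vec3_channelT x1 x y t.
have nD : \forall s \near (0 : R), D (s *: e_t R + (vec3 x1 x (clamp y), t)).
  by apply: near_channelT_tangent => //; rewrite !mxE.
have d := is_derive_coord 0 0 (is_derive_in nD (dg _ Dz)).
have e : \forall r \near (0 : R), profile x1 g (r + t) x y =
    g (r *: e_t R + (vec3 x1 x (clamp y), t)) 0 0.
  by near=> r; rewrite shift_e_t.
exact: (is_derive_line (phi := fun s => profile x1 g s x y) d e).
Unshelve. all: by end_near. Qed.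

(** Near an interior [y] the clamp is the identity; at a wall the constant extension may have a
    kink. *)
Lemma profile_derive_y x1 g (t x y : R) : y \in `]0, h[ ->
  (forall z, D z -> derivable_in D g z (e_x R 2)) ->
  is_derive y 1 (profile x1 g t x) (profile x1 (d_x D 2 g) t x y).
Proof.
move=> y0h dg; have Dz := vec3_channelT x1 x y t.
have Iz : inside (vec3 x1 x (clamp y), t).
  rewrite /inside /= vec3E clamp_id; last exact: subset_itv_oo_cc.
  by move: y0h; rewrite in_itv.
have d := is_derive_coord 0 0 (is_derive_in (near_channelT _ Iz) (dg _ Dz)).
have e : \forall r \near (0 : R), profile x1 g t x (r + y) =
    g (r *: e_x R 2 + (vec3 x1 x (clamp y), t)) 0 0.
  have := near_inside (e_x R 2) Iz; apply: filterS => r.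
  rewrite shift_e_x2 /inside /= vec3E (clamp_id (subset_itv_oo_cc y0h)) => ryh.
  rewrite /profile clamp_id// in_itv/=.
  by have /andP[? ?] := ryh; rewrite !ltW.
exact: (is_derive_line (phi := profile x1 g t x) d e).
Qed.

Lemma d_x_interior (W : normedModType R) i (f : spacetime R -> W) z :
  inside z -> d_x D i f z = 'D_(e_x R i) f z.
Proof. by move=> Iz; apply: derive_in_interior; exact: near_channelT. Qed.

Lemma is_derive_d_x (W : normedModType R) i (f : spacetime R -> W) z :
  inside z -> derivable_in D f z (e_x R i) ->
  is_derive z (e_x R i) f (d_x D i f z).
Proof. by move=> Iz df; exact: (is_derive_in (near_channelT _ Iz) df). Qed.

Lemma d_x_coord (g : spacetime R -> 'rV[R]_3) z i j :
  inside z -> derivable_in D g z (e_x R i) ->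
  d_x D i (fun w => g w 0 j : R) z = d_x D i g z 0 j.
Proof.
move=> Iz dg; rewrite d_x_interior//.
by have [_ ->] := is_derive_coord 0 j (is_derive_d_x Iz dg).
Qed.

(** A short line through an interior point stays inside, and along it the component is constantly
    zero. Applied repeatedly, this handles second derivatives too. *)
Lemma derive_in_coord0 (g : spacetime R -> 'rV[R]_3) z v j :
  inside z -> derivable_in D g z v ->
  (forall w, inside w -> g w 0 j = 0) -> derive_in D v g z 0 j = 0.
Proof.
move=> Iz dg g0.
have d := is_derive_coord 0 j (is_derive_in (near_channelT v Iz) dg).
have e : \forall r \near (0 : R), cst 0 (r + 0) = g (r *: v + z) 0 j.
  by have := near_inside v Iz; apply: filterS => r /g0.
have [_ <-] := is_derive_line (phi := cst 0) d e.
exact: derive_cst.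
Qed.

Lemma d_x_coord0 (g : spacetime R -> 'rV[R]_3) z i j :
  inside z -> derivable_in D g z (e_x R i) ->
  (forall w, inside w -> g w 0 j = 0) -> d_x D i g z 0 j = 0.
Proof. exact: derive_in_coord0. Qed.

Lemma d_t_coord0 (g : spacetime R -> 'rV[R]_3) z j :
  inside z -> derivable_in D g z (e_t R) ->
  (forall w, inside w -> g w 0 j = 0) -> d_t D g z 0 j = 0.
Proof. exact: derive_in_coord0. Qed.

End channel_geometry.

(** * Symmetry of the flow *)

Section channel_flow.
Context {R : realType}.
Local Notation mu := (@lebesgue_measure R).
Variables (nu h Pi1 Pi2 : R).
Hypotheses (nu_gt0 : 0 < nu) (h_gt0 : 0 < h)
  (Pi1_gt0 : 0 < Pi1) (Pi2_gt0 : 0 < Pi2).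
Variables (u : spacetime R -> 'rV[R]_3) (U P : spacetime R -> R).
Local Notation D := (channelT h).
Hypotheses (uE : forall z, D z -> u z = vec3 (U z) 0 0)
  (u_smooth : smooth D u) (uP_ns : navier_stokes D nu u P)
  (u_no_slip : no_slip h u) (u_periodic : periodic_x12 h Pi1 Pi2 u)
  (u_energy : (ereal_sup [set energy h Pi1 Pi2 u t | t in [set: R]] < +oo)%E).

Local Opaque d_x d_t.

Let u_derivable z : D z ->
  (forall i, derivable_in D u z (e_x R i)) /\ derivable_in D u z (e_t R).
Proof. by have [_ [+ _ _]] := u_smooth 2; exact. Qed.

Let dxu_derivable i z : D z -> forall j, derivable_in D (d_x D i u) z (e_x R j).
Proof. by have [_ [_ /(_ i) [_ [+ _ _]] _]] := u_smooth 2 => /[apply] -[]. Qed.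

Let u_continuous : {within D, continuous u}.
Proof. by have [] := u_smooth 0. Qed.

Let dtu_continuous : {within D, continuous (d_t D u)}.
Proof. by have [_ [_ _ []]] := u_smooth 2. Qed.

Let dxu_continuous i : {within D, continuous (d_x D i u)}.
Proof. by have [_ [_ /(_ i) [+ _] _]] := u_smooth 2. Qed.

Let dxxu_continuous i j : {within D, continuous (d_x D j (d_x D i u))}.
Proof. by have [_ [_ /(_ i) [_ [_ /(_ j) [+ _] _]] _]] := u_smooth 2. Qed.

Let u_coord0 (j : 'I_3) w : j != 0 -> inside h w -> u w 0 j = 0.
Proof.
move=> j0 /inside_channelT Dw; rewrite uE// mxE.
by case: j j0 => -[|[|[|//]]].
Qed.

Let dxu_coord0 (i j : 'I_3) w : j != 0 -> inside h w -> d_x D i u w 0 j = 0.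
Proof.
move=> j0 Iw; have [du _] := u_derivable (inside_channelT Iw).
by apply: (d_x_coord0 Iw (du i)) => z; exact: u_coord0.
Qed.

Let dtu_coord0 (j : 'I_3) w : j != 0 -> inside h w -> d_t D u w 0 j = 0.
Proof.
move=> j0 Iw; have [_ du] := u_derivable (inside_channelT Iw).
by apply: (d_t_coord0 Iw du) => z; exact: u_coord0.
Qed.

Let dxxu_coord0 (i k j : 'I_3) w : j != 0 -> inside h w ->
  d_x D k (d_x D i u) w 0 j = 0.
Proof.
move=> j0 Iw; have du := @dxu_derivable i w (inside_channelT Iw) k.
by apply: (d_x_coord0 Iw du) => z; exact: dxu_coord0.
Qed.

(** The other two terms of the divergence differentiate components that vanish identically. *)
Let dx0u w : inside h w -> d_x D 0 u w 0 0 = 0.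
Proof.
move=> Iw; have Dw := inside_channelT Iw; have [du _] := u_derivable Dw.
have [_ _ div0] := uP_ns Dw; rewrite -(d_x_coord 0 Iw (du 0)).
apply: (sum_ord3_eq0 (F := fun i => d_x D i (fun z => u z 0 i : R) w) div0).
- by rewrite (d_x_coord 1 Iw (du 1)); exact: dxu_coord0.
- by rewrite (d_x_coord 2 Iw (du 2)); exact: dxu_coord0.
Qed.

Let dx0x0u w : inside h w -> d_x D 0 (d_x D 0 u) w 0 0 = 0.
Proof.
move=> Iw; have du := @dxu_derivable 0 w (inside_channelT Iw) 0.
by apply: (d_x_coord0 Iw du) => z; exact: dx0u.
Qed.

Let dx2P w : inside h w -> d_x D 2 P w = 0.
Proof.
move=> Iw; have [_ ns _] := uP_ns (inside_channelT Iw).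
apply: (momentum_transverse (ux := fun i => d_x D i u w)
  (uxx := fun i => d_x D i (d_x D i u) w) (p := fun i => d_x D i P w) ns).
- exact: dtu_coord0.
- by move=> i; exact: dxu_coord0.
- by move=> i; exact: dxxu_coord0.
Qed.

Let heat_P w : inside h w -> d_t D u w 0 0 =
  nu * (d_x D 1 (d_x D 1 u) w 0 0 + d_x D 2 (d_x D 2 u) w 0 0) - d_x D 0 P w.
Proof.
move=> Iw; have [_ ns _] := uP_ns (inside_channelT Iw).
apply: (momentum_streamwise (ux := fun i => d_x D i u w)
  (uxx := fun i => d_x D i (d_x D i u) w) (p := fun i => d_x D i P w) ns).
- exact: u_coord0.
- exact: u_coord0.
- exact: dx0u.
- exact: dx0x0u.
Qed.

Let insideE x1 x y t : inside h (vec3 x1 x y, t) <-> y \in `]0, h[.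
Proof. by rewrite /inside /= vec3E in_itv. Qed.

(** The segment between two interior heights avoids the walls, so [dx2P] holds along all of it and
    the mean value theorem applies. *)
Let P_const_x3 (x1 x y y' t : R) : y \in `]0, h[ -> y' \in `]0, h[ ->
  P (vec3 x1 x y, t) = P (vec3 x1 x y', t).
Proof.
wlog yy' : y y' / y <= y'.
  move=> H yh y'h; have [/H|/ltW/H] := leP y y'; first exact.
  by move=> /(_ y'h yh)/esym.
move=> yh y'h.
have dP (s : R) : s \in `[y, y'] ->
    is_derive s 1 (fun s => P (vec3 x1 x s, t)) 0.
  move=> ys.
  have Iz : inside h (vec3 x1 x s, t).
    apply/insideE; move: yh y'h ys; rewrite !in_itv/=.
    move=> /andP[y0 _] /andP[_ y'h] /andP[ys sy'].
    by rewrite (lt_le_trans y0 ys) (le_lt_trans sy' y'h).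
  have [dP _ _] := uP_ns (inside_channelT Iz).
  have := is_derive_d_x Iz (dP 2); rewrite dx2P// => d.
  have e : \forall r \near (0 : R), P (vec3 x1 x (r + s), t) =
      P (r *: e_x R 2 + (vec3 x1 x s, t)).
    by near=> r; rewrite shift_e_x2.
  exact: (is_derive_line (phi := fun s => P (vec3 x1 x s, t)) d e).
have dP' (s : R) : s \in `]y, y'[ ->
    is_derive s 1 (fun s => P (vec3 x1 x s, t)) 0.
  by move=> /subset_itv_oo_cc; exact: dP.
have cP : {within `[y, y'], continuous (fun s => P (vec3 x1 x s, t))}.
  by apply: derivable_within_continuous => s /dP[].
have [c _] := MVT_segment yy' dP' cP.
by rewrite mul0r => /eqP; rewrite subr_eq0 => /eqP.
Unshelve. all: by end_near. Qed.

(** Only first derivatives of [P] are given, so mixed derivatives are not exchanged; instead the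
    difference quotients in [x_1] at the two heights are equal term by term. *)
Let dx0P_const_x3 (x1 x y y' t : R) : y \in `]0, h[ -> y' \in `]0, h[ ->
  d_x D 0 P (vec3 x1 x y, t) = d_x D 0 P (vec3 x1 x y', t).
Proof.
move=> yh y'h; rewrite !d_x_interior; try exact/insideE.
rewrite /derive; congr (lim (_ @ 0^')); apply/funext => r /=.
by rewrite !shift_e_x0 (P_const_x3 _ _ _ yh y'h) (P_const_x3 _ _ _ yh y'h).
Qed.

Let u_wall x1 x y t : y = 0 \/ y = h -> u (vec3 x1 x y, t) = 0.
Proof. by move=> yh; apply: u_no_slip; rewrite vec3E. Qed.

(** Inside, the derivative along the whole [x_1]-line is zero by [dx0u]; on the walls no-slip gives
    the equality. *)
Let u_const_x1 (a b x y t : R) : y \in `[0, h] ->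
  u (vec3 a x y, t) 0 0 = u (vec3 b x y, t) 0 0.
Proof.
rewrite in_itv/= => /andP[].
rewrite le_eqVlt => /predU1P[<- _|y0]; first by rewrite !u_wall//; left.
rewrite le_eqVlt => /predU1P[->|yh]; first by rewrite !u_wall//; right.
have d (s : R) : is_derive s 1 (fun s => u (vec3 s x y, t) 0 0) 0.
  have Iz : inside h (vec3 s x y, t) by apply/insideE; rewrite in_itv/= y0.
  have [du _] := u_derivable (inside_channelT Iz).
  have := is_derive_coord 0 0 (is_derive_d_x Iz (du 0)); rewrite dx0u// => d.
  have e : \forall r \near (0 : R), u (vec3 (r + s) x y, t) 0 0 =
      u (r *: e_x R 0 + (vec3 s x y, t)) 0 0.
    by near=> r; rewrite shift_e_x0.
  exact: (is_derive_line (phi := fun s => u (vec3 s x y, t) 0 0) d e).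
exact: (is_derive_0_is_cst a b d).
Unshelve. all: by end_near. Qed.

Let profile_periodic x1 (t x y : R) :
  profile h x1 u t (x + Pi2) y = profile h x1 u t x y.
Proof.
have ch : channel h (vec3 x1 x (clamp h y)).
  by rewrite /channel/= vec3E; exact: clamp_itv.
have [_ uP2] := u_periodic t ch.
rewrite /profile -uP2; congr (u (_, _) 0 0).
by apply/rowP => -[[|[|[|//]]] i3]; rewrite !mxE/= ?mulr1 ?mulr0 ?addr0.
Qed.

Local Notation f x1 := (profile h x1 u).

Let cf x1 : jointly_continuous (f x1).
Proof. by move=> p; exact: (continuous_profile h_gt0 u_continuous). Qed.

Let csq x1 : jointly_continuous (fun t x y => f x1 t x y * f x1 t x y).
Proof. by apply: jointly_continuousM; exact: cf. Qed.

Let cint (G : R -> R -> R -> R) t : jointly_continuous G ->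
  continuous (fun x => \int[mu]_(y in `[0, h]) G t x y).
Proof.
move=> cG; apply: (@continuous_Rintegral R R 0 h (G t)); last exact: ltW.
exact: (jointly_continuous_section1 (t := t) cG).
Qed.

Let energy_density x1 (a x y t : R) : y \in `[0, h] ->
  dot (u (vec3 a x y, t)) (u (vec3 a x y, t)) = f x1 t x y * f x1 t x y.
Proof.
move=> y0h; have Dz : D (vec3 a x y, t).
  by split => //=; rewrite /channel /= vec3E; move: y0h; rewrite in_itv.
rewrite /profile (clamp_id y0h) -(u_const_x1 a x1 x t y0h) /dot sum_ord3.
by rewrite (uE Dz) !vec3E !mul0r !addr0.
Qed.

(** The density does not depend on [x_1], so the outer integral contributes the factor [Pi1];
    continuity makes the inner extended integrals real, from the innermost outwards. *)
Let energyE x1 t : energy h Pi1 Pi2 u t =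
  (Pi1 * \int[mu]_(x in `[0%R, Pi2]) \int[mu]_(y in `[0%R, h])
    (f x1 t x y * f x1 t x y))%:E.
Proof.
rewrite /energy.
under eq_integral => a _.
  under eq_integral => x _.
    under eq_integral => y.
      rewrite inE => y0h; rewrite (energy_density x1 a x t y0h).
      over.
    rewrite -(EFin_Rintegral_cc 0 h
      (jointly_continuous_section (t := t) (x := x) (@csq x1))).
    over.
  rewrite -(EFin_Rintegral_cc 0 Pi2 (cint (t := t) (@csq x1))).
  over.
rewrite integral_cst//= muleC; have -> := lebesgue_measure_itv `[0%R, Pi1].
by rewrite /= lte_fin Pi1_gt0 sube0.
Qed.

Let energy_bounded x1 : exists M, forall t,
  \int[mu]_(x in `[0, Pi2]) \int[mu]_(y in `[0, h])
    (f x1 t x y * f x1 t x y) <= M.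
Proof.
pose S := ereal_sup [set energy h Pi1 Pi2 u t | t in [set: R]].
have ub t : (energy h Pi1 Pi2 u t <= S)%E.
  by apply: ereal_sup_ubound; exists t.
(* With the assumed upper bound this makes the supremum a real number; the energy at time 0 is the
   witness. *)
have S0 : (0 <= S)%E.
  apply: le_trans (ub 0); rewrite (energyE x1 0) lee_fin.
  apply: mulr_ge0; first exact: ltW.
  by apply: Rintegral_ge0 => x _; apply: Rintegral_ge0 => y _; exact: sqr_ge0.
have Sfin : S \is a fin_num by rewrite ge0_fin_numE.
exists (fine S / Pi1) => t; rewrite ler_pdivlMr// mulrC -lee_fin fineK//.
by rewrite -energyE.
Qed.

Lemma profile_symmetric x1 (t x y : R) : x \in `[0, Pi2] -> y \in `]0, h[ ->
  f x1 t x (h - y) = f x1 t x y.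
Proof.
move=> x0L y0h.
pose refl_sub (g : R -> R -> R -> R) (s r z : R) := g s r (h - z) - g s r z.
have c_refl_sub g : jointly_continuous g -> jointly_continuous (refl_sub g).
  move=> cg; apply: jointly_continuousB => //.
  exact: jointly_continuous_reflect.
pose fy := profile h x1 (d_x D 2 u).
(* Reflection flips the sign of a first derivative in [x_3], hence a sum here instead of [refl_sub];
   the second derivative restores the sign. *)
pose Zy (s r z : R) := - fy s r (h - z) - fy s r z.
have itv_r z : z \in `]0, h[ -> h - z \in `]0, h[.
  by rewrite !in_itv/= => /andP[? ?]; apply/andP; split; lra.
have cp g : {within D, continuous g} -> jointly_continuous (profile h x1 g).
  exact: continuous_profile.
have cZy : jointly_continuous Zy.
  have cfy : jointly_continuous fy by exact/cp/dxu_continuous.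
  move=> p; apply: cvgB; last exact: cfy.
  by apply: cvgN; exact: (@jointly_continuous_reflect R fy h cfy p).
have du i z : D z -> derivable_in D u z (e_x R i).
  by move=> /u_derivable[+ _]; exact.
have dut z : D z -> derivable_in D u z (e_t R) by move=> /u_derivable[].
have ddu i z : D z -> derivable_in D (d_x D i u) z (e_x R i).
  by move=> Dz; exact: (@dxu_derivable i z Dz).
have dl (z : R) : is_derive z 1 (fun z => h - z) (-1).
  have := is_deriveB (is_derive_cst h z 1) (is_derive_id z (1 : R)).
  by rewrite sub0r.
have dr (g : R -> R) (z dg : R) : is_derive (h - z) 1 g dg ->
    is_derive z 1 (fun z => g (h - z)) (- dg).
  move=> d; have := @is_derive1_comp _ g _ z _ _ d (dl z).
  by rewrite mulrN1.
have dZt (s r z : R) : z \in `[0, h] -> is_derive s 1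
    (fun s => refl_sub (f x1) s r z)
    (refl_sub (profile h x1 (d_t D u)) s r z).
  move=> _; exact: (is_deriveB (profile_derive_t h_gt0 x1 s r (h - z) dut)
    (profile_derive_t h_gt0 x1 s r z dut)).
have dZx (s r z : R) : z \in `[0, h] -> is_derive r 1
    (fun r => refl_sub (f x1) s r z)
    (refl_sub (profile h x1 (d_x D 1 u)) s r z).
  move=> _; exact: (is_deriveB (profile_derive_x h_gt0 x1 s r (h - z) (du 1))
    (profile_derive_x h_gt0 x1 s r z (du 1))).
have dZxx (s r z : R) : z \in `[0, h] -> is_derive r 1
    (fun r => refl_sub (profile h x1 (d_x D 1 u)) s r z)
    (refl_sub (profile h x1 (d_x D 1 (d_x D 1 u))) s r z).
  move=> _; exact: (is_deriveB (profile_derive_x h_gt0 x1 s r (h - z) (ddu 1))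
    (profile_derive_x h_gt0 x1 s r z (ddu 1))).
have dZy (s r z : R) : z \in `]0, h[ -> is_derive z 1
    (refl_sub (f x1) s r) (Zy s r z).
  move=> z0h; have d1 := profile_derive_y h_gt0 x1 s r z0h (du 2).
  have d2 := profile_derive_y h_gt0 x1 s r (itv_r _ z0h) (du 2).
  exact: (is_deriveB (dr _ _ _ d2) d1).
have dZyy (s r z : R) : z \in `]0, h[ -> is_derive z 1 (Zy s r)
    (refl_sub (profile h x1 (d_x D 2 (d_x D 2 u))) s r z).
  move=> z0h; have d1 := profile_derive_y h_gt0 x1 s r z0h (ddu 2).
  have d2 := profile_derive_y h_gt0 x1 s r (itv_r _ z0h) (ddu 2).
  have := is_deriveB (is_deriveN (dr _ _ _ d2)) d1.
  by rewrite opprK.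
have f_wall s r : f x1 s r 0 = 0 /\ f x1 s r h = 0.
  rewrite /profile !clamp_id ?in_itv/= ?lexx ?ltW// !u_wall ?mxE//.
    by right.
  by left.
have Z_wall s r : refl_sub (f x1) s r 0 = 0 /\ refl_sub (f x1) s r h = 0.
  have [f0 fh] := f_wall s r.
  by rewrite /refl_sub subr0 subrr f0 fh subrr.
have Z_periodic (s r z : R) : z \in `[0, h] ->
    refl_sub (f x1) s (r + Pi2) z = refl_sub (f x1) s r z.
  by move=> _; rewrite /refl_sub !profile_periodic.
have Z_heat (s r z : R) : z \in `]0, h[ ->
    refl_sub (profile h x1 (d_t D u)) s r z =
    nu * (refl_sub (profile h x1 (d_x D 1 (d_x D 1 u))) s r z +
          refl_sub (profile h x1 (d_x D 2 (d_x D 2 u))) s r z).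
  move=> z0h; have hz := itv_r _ z0h.
  rewrite /refl_sub /profile !clamp_id; try exact: subset_itv_oo_cc.
  have e1 := heat_P ((insideE x1 r (h - z) s).2 hz).
  have e2 := heat_P ((insideE x1 r z s).2 z0h).
  (* The equations at heights [h - z] and [z] carry the same pressure gradient, which cancels on
     subtraction. *)
  have subE (a a' b b' c c' p p' : R) : a = nu * (b + c) - p ->
      a' = nu * (b' + c') - p' -> p = p' -> a - a' = nu * ((b - b') + (c - c')).
    by move=> -> -> ->; ring.
  exact: (subE _ _ _ _ _ _ _ _ e1 e2 (dx0P_const_x3 x1 r s hz z0h)).
have [M fM] := energy_bounded x1.
have cZ : jointly_continuous (refl_sub (f x1)) by exact/c_refl_sub/cf.
(* The 4 arises from [(a - b)^2 <= 2 (a^2 + b^2)] together with the equality of the integrals of the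
   two squares, which are reflections of each other. *)
have Z_bounded s : \int[mu]_(r in `[0, Pi2]) \int[mu]_(z in `[0, h])
    (refl_sub (f x1) s r z * refl_sub (f x1) s r z) <= 4 * M.
  apply: (@le_trans _ _ (4 * \int[mu]_(r in `[0, Pi2]) \int[mu]_(z in `[0, h])
      (f x1 s r z * f x1 s r z))); last by rewrite ler_pM2l.
  have ci1 := cint (t := s) (@csq x1).
  have ci2 := cint (t := s) (jointly_continuousM cZ cZ).
  have ci3 : continuous (fun r => 4 * \int[mu]_(z in `[0, h])
      (f x1 s r z * f x1 s r z)).
    by move=> r; apply: cvgM; [exact: cvg_cst|exact: ci1].
  rewrite -RintegralZl//; last exact: continuous_integrable_cc.
  apply: le_Rintegral => //; [exact: continuous_integrable_cc..|].
  move=> r _.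
  have g1 : continuous (fun z => f x1 s r z * f x1 s r z).
    exact: (jointly_continuous_section (t := s) (x := r) (@csq x1)).
  have g2 : continuous (fun z => f x1 s r (h - z) * f x1 s r (h - z)).
    exact: (jointly_continuous_section (t := s) (x := r)
      (@jointly_continuous_reflect R _ h (@csq x1))).
  have g12 : continuous (fun z => f x1 s r (h - z) * f x1 s r (h - z) +
      f x1 s r z * f x1 s r z).
    by move=> z; apply: cvgD; [exact: g2|exact: g1].
  have -> : 4 * \int[mu]_(z in `[0, h]) (f x1 s r z * f x1 s r z) =
      \int[mu]_(z in `[0, h]) (2 * (f x1 s r (h - z) * f x1 s r (h - z) +
      f x1 s r z * f x1 s r z)).
    rewrite RintegralZl//; last exact: continuous_integrable_cc.
    rewrite RintegralD//; [|exact: continuous_integrable_cc..].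
    by rewrite (Rintegral_reflect h_gt0 g1); ring.
  apply: le_Rintegral => //.
  - apply: continuous_integrable_cc.
    exact: (jointly_continuous_section (t := s) (x := r)
      (jointly_continuousM cZ cZ)).
  - apply: continuous_integrable_cc => z.
    by apply: cvgM; [exact: cvg_cst|exact: g12].
  - move=> z _; rewrite /refl_sub -subr_ge0.
    rewrite (_ : _ - _ = (f x1 s r (h - z) + f x1 s r z) ^+ 2); last by ring.
    exact: sqr_ge0.
apply/eqP; rewrite -subr_eq0; apply/eqP.
exact: (bounded_heat_solution_eq0 nu_gt0 h_gt0 Pi2_gt0 cZ
  (c_refl_sub _ (cp _ dtu_continuous)) (c_refl_sub _ (cp _ (@dxu_continuous 1)))
  (c_refl_sub _ (cp _ (@dxxu_continuous 1 1))) cZy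
  (c_refl_sub _ (cp _ (@dxxu_continuous 2 2)))
  dZt dZx dZxx dZy dZyy Z_wall Z_periodic Z_heat Z_bounded t x0L y0h).
Qed.

Lemma avg2_symmetric (x1 x3 t : R) : 0 <= x3 <= h ->
  avg2 Pi2 U x1 (h - x3) t = avg2 Pi2 U x1 x3 t.
Proof.
move=> x3h; congr (_ * _); apply: eq_Rintegral => x; rewrite inE/= => x0L.
(* [U] is tied to [u] only on the channel, so both heights [x3] and [h - x3] have to be placed in
   [[0, h]]. *)
have UE y : y \in `[0, h] -> U (vec3 x1 x y, t) = f x1 t x y.
  move=> y0h; rewrite /profile clamp_id// uE ?vec3E//.
  by split => //=; rewrite /channel /= vec3E; move: y0h; rewrite in_itv.
rewrite !UE ?in_itv//=; last by have /andP[? ?] := x3h; apply/andP; split; lra.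
have /andP[] := x3h.
(* Reflection exchanges the walls, where no-slip makes both values zero; interior heights follow
   from [profile_symmetric]. *)
rewrite le_eqVlt => /predU1P[<- _|y0].
  rewrite subr0 /profile !clamp_id ?in_itv/= ?lexx ?ltW// !u_wall//.
    by left.
  by right.
rewrite le_eqVlt => /predU1P[->|yh].
  rewrite subrr /profile !clamp_id ?in_itv/= ?lexx ?ltW// !u_wall//.
    by right.
  by left.
by apply: profile_symmetric; rewrite // in_itv/= y0.
Qed.

End channel_flow.

Theorem theorem3p2 (R : realType) (nu h Pi1 Pi2 : R)
  (nu_gt0 : 0 < nu) (h_gt0 : 0 < h) (Pi1_gt0 : 0 < Pi1) (Pi2_gt0 : 0 < Pi2)
  (u : spacetime R -> 'rV[R]_3) (U P : spacetime R -> R)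
  (uE : forall z, channelT h z -> u z = vec3 (U z) 0 0)
  (u_smooth : smooth (channelT h) u)
  (uP_ns : navier_stokes (channelT h) nu u P)
  (u_no_slip : no_slip h u)
  (u_periodic : periodic_x12 h Pi1 Pi2 u)
  (u_energy : (ereal_sup [set energy h Pi1 Pi2 u t | t in [set: R]] < +oo)%E) :
  forall x1 x3 t : R, 0 <= x3 <= h ->
    avg2 Pi2 U x1 (h - x3) t = avg2 Pi2 U x1 x3 t.
Proof.
exact: (avg2_symmetric nu_gt0 h_gt0 Pi1_gt0 Pi2_gt0 uE u_smooth uP_ns u_no_slip
  u_periodic u_energy).
Qed.
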